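(* Consider the linear, constant-coefficient setting with the quantities defined in the context. Let $m\in\{1,2,\ldots,M\}$, suppose that $$\left\|\hat Q_R^{\mathrm{step}}-\mathscr{E}(\hat Q_R)\right\|=O\!\left((\Delta t)^2,(\Delta t)^{k+1}\right),$$ and suppose that $$P^{(m)}-\max(\lambda^{(m)}-\dot x_R,0)\frac{\gamma_R}{\Delta x_{J+1/2}}\;\le\; D^{(m)}\;\le\;\frac{2}{\Delta t}-\max(\lambda^{(m)}-\dot x_R,0)\frac{\gamma_R}{\Delta x_{J+1/2}}-P^{(m)} .$$ Then $$\left|\mathscr{E}(l^{(m)}Q_R)-\mathscr{E}(l^{(m)}\hat Q_R)\right|\le\left|l^{(m)}(Q_R-\hat Q_R)\right|+O\!\left((\Delta t)^2,(\Delta t)^{k+1}\right).$$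
   Context: Setting. Consider the hyperbolic system $\partial_t Q+\partial_x F=\Psi$ with $Q(x,t)\in\mathbb{R}^M$ on $x_L(t)\le x\le x_R(t)$, where the flux is linear in $Q$, so that $A=\partial F/\partial Q$ is a constant matrix, diagonalisable with real eigenvalues $\lambda^{(1)}\le\cdots\le\lambda^{(M)}$ and corresponding (constant) left eigenvectors (row vectors) $l^{(m)}$. Put $\Psi'=\Psi-\partial F/\partial x$ (partial derivative with respect to the explicit $x$-dependence). The source satisfies, for constants $P^{(m)}>0$, $$|l^{(m)}\cdot(\Psi'(Q_1,x_R,t)-\Psi'(Q_2,x_R,t))|\le P^{(m)}|l^{(m)}\cdot(Q_1-Q_2)|\quad\text{for all }Q_1,Q_2\in\mathbb{R}^M.$$ $\dot x_R=dx_R/dt$ is the velocity of the right boundary. Discretization at a fixed time $t$. There are grid points $x_1<\cdots<x_J<x_R$ with bulk values $Q_1,\ldots,Q_J$, a boundary value $Q_R=Q_{J+1}$ at $x_R$, and $\Delta x_{J+1/2}=x_R-x_J$. An integer $k\ge0$ is fixed. The extrapolated value is $\hat Q_R=\sum_{j=J-k}^{J}\kappa_jQ_j$ with fixed real coefficients $\kappa_j$. The gradient function, with fixed real coefficients $\gamma_j$, is $$\Gamma(\bar Q_R,\bar Q_J,\ldots,\bar Q_{J-k+1})=\frac{1}{\Delta x_{J+1/2}}\left(\gamma_R\bar Q_R+\gamma_J\bar Q_J+\cdots+\gamma_{J-k+1}\bar Q_{J-k+1}\right),$$ (for $k=0$, $\Gamma\equiv0$ and $\gamma_R=0$), and $Q_{xR}=\Gamma(Q_R,Q_J,\ldots,Q_{J-k+1})$,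 $\hat Q_{xR}=\Gamma(\hat Q_R,Q_J,\ldots,Q_{J-k+1})$. The bulk values are treated as independent of $Q_R$. Time stepping. $\mathscr{E}$ denotes the result of an Euler time-step of size $\Delta t$. For the boundary value, with forcing coefficient $D^{(m)}\ge0$, $$\mathscr{E}(l^{(m)}Q_R)=l^{(m)}Q_R+\Delta t\left(-\max(\lambda^{(m)}-\dot x_R,0)\,l^{(m)}Q_{xR}+l^{(m)}\Psi'(Q_R,x_R,t)+D^{(m)}\,l^{(m)}(\hat Q_R-Q_R)\right).$$ $\mathscr{E}(\hat Q_R)$ is the extrapolated value after the Euler step of the bulk values by the bulk scheme, and $\mathscr{E}(l^{(m)}\hat Q_R)=l^{(m)}\mathscr{E}(\hat Q_R)$. The vector $\hat Q_R^{\mathrm{step}}$ is defined by $$l^{(m)}\hat Q_R^{\mathrm{step}}=l^{(m)}\hat Q_R+\Delta t\left(-\max(\lambda^{(m)}-\dot x_R,0)\,l^{(m)}\hat Q_{xR}+l^{(m)}\Psi'(\hat Q_R,x_R,t)\right)\quad\text{for all }m.$$ The notation $O(a,b)$ means $O(|a|+|b|)$, as $\Delta t\to0$. *)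

(* Defs.v *)
From HB Require Import structures.
From mathcomp Require Import all_boot all_order all_algebra.
From mathcomp Require Import all_classical all_reals all_analysis.

Set Implicit Arguments.
Unset Strict Implicit.
Unset Printing Implicit Defensive.

Import Order.TTheory GRing.Theory Num.Theory.
Import numFieldNormedType.Exports.

Local Open Scope ring_scope.
Local Open Scope classical_set_scope.

Definition rowdot (R : realType) (M : nat) (l : 'rV[R]_M) (v : 'cV[R]_M) : R :=
  (l *m v) ord0 ord0.

(* A is diagonalisable over R, with eigenvalues lam and left eigenvectors l. *)
Definition left_eigensystem (R : realType) (M : nat) (A : 'M[R]_M)
    (lam : 'I_M -> R) (l : 'I_M -> 'rV[R]_M) : Prop :=
  [/\ forall m n : 'I_M, (m <= n)%N -> lam m <= lam n,
      forall m : 'I_M, l m *m A = lam m *: l m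
    & row_free (\matrix_(m < M) l m)].

(* On the strip xL s <= x <= xR s, the Jacobian dF/dQ is the constant matrix A
   and the explicit derivative dF/dx exists. *)
Definition linear_flux (R : realType) (M : nat)
    (F : 'cV[R]_M -> R -> R -> 'cV[R]_M) (A : 'M[R]_M) (xL xR : R -> R) : Prop :=
  forall (Q : 'cV[R]_M) (x s : R), xL s <= x <= xR s ->
    is_diff Q (fun Q' : 'cV[R]_M => F Q' x s) (fun V : 'cV[R]_M => A *m V) /\
    derivable (fun y : R => F Q y s) x 1.

Definition modified_source (R : realType) (M : nat)
    (Psi F : 'cV[R]_M -> R -> R -> 'cV[R]_M) (Q : 'cV[R]_M) (x s : R) : 'cV[R]_M :=
  Psi Q x s - derive1 (fun y : R => F Q y s) x.

(* Stencils are indexed by the distance i to the last bulk point J, because J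
   varies with the grid while the coefficients do not: kappa i multiplies
   Q_(J - i) for 0 <= i <= k. *)
Definition extrapolation (R : realType) (M k : nat) (kappa : 'I_k.+1 -> R)
    (J : nat) (Q : nat -> 'cV[R]_M) : 'cV[R]_M :=
  \sum_(i < k.+1) kappa i *: Q (J - i)%N.

(* gamma i multiplies Q_(J - i) for 0 <= i < k. *)
Definition gradient (R : realType) (M k : nat) (gammaR : R) (gamma : 'I_k -> R)
    (dx : R) (QR : 'cV[R]_M) (J : nat) (Q : nat -> 'cV[R]_M) : 'cV[R]_M :=
  dx^-1 *: (gammaR *: QR + \sum_(i < k) gamma i *: Q (J - i)%N).

(* An Euler step of size dt of the characteristic variable l . Q, given the
   gradient Qx, the modified source S and the scalar forcing f. *)
Definition characteristic_step (R : realType) (M : nat) (l : 'rV[R]_M)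
    (lam velR dt : R) (Q Qx S : 'cV[R]_M) (f : R) : R :=
  rowdot l Q
  + dt * (- Num.max (lam - velR) 0 * rowdot l Qx + rowdot l S + f).

(* The points grid 1 < ... < grid J lie strictly to the left of xR, and J > k,
   so that the stencils above only use indices in 1..J. *)
Definition admissible_grid (R : realType) (k J : nat) (grid : nat -> R) (xR : R)
    : Prop :=
  [/\ (k < J)%N,
      forall j : nat, (0 < j < J)%N -> grid j < grid j.+1
    & grid J < xR].

(* Main.v *)
Require Import Defs.
From HB Require Import structures.
From mathcomp Require Import all_boot all_order all_algebra.
From mathcomp Require Import all_classical all_reals all_analysis.
From mathcomp Require Import ring lra.

(** The vector [Qstep] is the reference to compare with: it evolves the
    extrapolated value by the unforced boundary equation, so its distance to
    the extrapolation of the stepped bulk values is a pure consistency error.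
    Inserting it splits the difference of the two stepped values in two.

    The part between the boundary step and [Qstep] is a stability question.
    With a := l . (QR - Qhat), subtracting the two Euler steps gives
    a + dt * (b - (slope + D) * a): the gradients share their bulk values, so
    they differ only through the boundary coefficient, which gives the term
    slope * a ([rowdot_gradientB]); the forcing gives D * a; and the source
    gives b, with |b| <= P * |a|. The window imposed on D amounts to
    P <= slope + D <= 2 / dt - P, for which this map does not increase |a|
    ([damped_step_contraction]).

    The part between [Qstep] and the extrapolated bulk step is |l . v| for the
    consistency error v; since |l . v| is at most a constant times the norm of
    v ([ler_rowdot_norm]), it is of the required order and serves as the error
    term. *)

Set Implicit Arguments.
Unset Strict Implicit.
Unset Printing Implicit Defensive.

Import Order.TTheory GRing.Theory Num.Theory.
Import numFieldNormedType.Exports.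

Local Open Scope ring_scope.
Local Open Scope classical_set_scope.

Lemma rowdotD (R : realType) (M : nat) (l : 'rV[R]_M) (u v : 'cV[R]_M) :
  rowdot l (u + v) = rowdot l u + rowdot l v.
Proof. by rewrite /rowdot mulmxDr mxE. Qed.

Lemma rowdotZ (R : realType) (M : nat) (l : 'rV[R]_M) (a : R) (v : 'cV[R]_M) :
  rowdot l (a *: v) = a * rowdot l v.
Proof. by rewrite /rowdot -scalemxAr mxE. Qed.

Lemma rowdotB (R : realType) (M : nat) (l : 'rV[R]_M) (u v : 'cV[R]_M) :
  rowdot l (u - v) = rowdot l u - rowdot l v.
Proof. by rewrite -scaleN1r rowdotD rowdotZ mulN1r. Qed.

(** Matrices carry the maximum norm, whose dual norm is the sum of absolute
    values: this makes the consistency assumption, given in norm, usable along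
    a single characteristic. *)
Lemma ler_rowdot_norm (R : realType) (M : nat) (l : 'rV[R]_M) (v : 'cV[R]_M) :
  `|rowdot l v| <= (\sum_(i < M) `|l ord0 i|) * `|v|.
Proof.
rewrite /rowdot mxE mulr_suml; apply: le_trans (ler_norm_sum _ _ _) _.
apply: ler_sum => i _; rewrite normrM ler_wpM2l //.
rewrite [leRHS]mx_normrE.
exact: (le_bigmax _ (fun ij => `|v ij.1 ij.2|) (i, ord0)).
Qed.

(** The stencil of bulk values is common to both gradients and cancels, which
    leaves only the contribution of the boundary coefficient. *)
Lemma rowdot_gradientB (R : realType) (M k : nat) (l : 'rV[R]_M) (gammaR : R)
    (gamma : 'I_k -> R) (dx : R) (U V : 'cV[R]_M) (J : nat)
    (Q : nat -> 'cV[R]_M) :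
  rowdot l (gradient gammaR gamma dx U J Q)
    - rowdot l (gradient gammaR gamma dx V J Q)
  = gammaR / dx * rowdot l (U - V).
Proof.
rewrite -rowdotB /gradient -scalerBr opprD addrACA subrr addr0 -scalerBr.
by rewrite scalerA rowdotZ [dx^-1 * _]mulrC.
Qed.

(** Without [b] the step multiplies [a] by [1 - dt * c], and the two bounds on
    [c] say exactly that this factor has absolute value at most [1 - dt * p].
    The margin [dt * p] is what the Lipschitz perturbation [b] may use up. *)
Lemma damped_step_contraction (R : realType) (dt c p a b : R) :
    0 < dt -> p <= c <= 2 / dt - p -> `|b| <= p * `|a| ->
  `|a + dt * (b - c * a)| <= `|a|.
Proof.
move=> dt0 /andP[pc cp] bp.
have -> : a + dt * (b - c * a) = (1 - dt * c) * a + dt * b by ring.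
have contr : `|1 - dt * c| <= 1 - dt * p.
  have lo : dt * p <= dt * c by rewrite ler_pM2l.
  have hi : dt * c <= 2 - dt * p.
    have : dt * c <= dt * (2 / dt - p) by rewrite ler_pM2l.
    by rewrite mulrBr mulrCA divff ?gt_eqF // mulr1.
  by rewrite ler_norml; apply/andP; split; lra.
apply: le_trans (ler_normD _ _) _; rewrite !normrM (gtr0_norm dt0).
rewrite [leRHS](_ : _ = (1 - dt * p) * `|a| + dt * (p * `|a|)); last by ring.
by apply: lerD; [rewrite ler_wpM2r | rewrite ler_wpM2l // ltW].
Qed.

Theorem theorem3p1 (R : realType) (M : nat)
    (* the hyperbolic system *)
    (F Psi : 'cV[R]_M -> R -> R -> 'cV[R]_M) (A : 'M[R]_M)
    (lam : 'I_M -> R) (l : 'I_M -> 'rV[R]_M) (P : 'I_M -> R)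
    (xL xR : R -> R) (t : R)
    (hx : forall s : R, xL s <= xR s)
    (hxR : derivable xR t 1)
    (hF : linear_flux F A xL xR)
    (hA : left_eigensystem A lam l)
    (hP : forall n : 'I_M, 0 < P n)
    (hPsi : forall (n : 'I_M) (Q1 Q2 : 'cV[R]_M),
      `|rowdot (l n) (modified_source Psi F Q1 (xR t) t
                      - modified_source Psi F Q2 (xR t) t)|
      <= P n * `|rowdot (l n) (Q1 - Q2)|)
    (* the fixed extrapolation and gradient coefficients *)
    (k : nat) (kappa : 'I_k.+1 -> R) (gammaR : R) (gamma : 'I_k -> R)
    (hgamma : k = 0%N -> gammaR = 0)
    (* the discrete data at time t, for each time-step dt > 0; [EQ dt j] is the
       bulk value at the j-th point after the Euler step of the bulk scheme *)
    (J : R -> nat) (grid : R -> nat -> R)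
    (Q EQ : R -> nat -> 'cV[R]_M) (QR Qstep : R -> 'cV[R]_M)
    (D : R -> 'I_M -> R)
    (hgrid : forall dt : R, 0 < dt ->
      admissible_grid k (J dt) (grid dt) (xR t))
    (hD : forall (dt : R) (n : 'I_M), 0 < dt -> 0 <= D dt n)
    (m : 'I_M) :
  let velR : R := derive1 xR t in
  let dx (dt : R) : R := xR t - grid dt (J dt) in
  let Qhat (dt : R) : 'cV[R]_M := extrapolation kappa (J dt) (Q dt) in
  let EQhat (dt : R) : 'cV[R]_M := extrapolation kappa (J dt) (EQ dt) in
  let Gamma (dt : R) (V : 'cV[R]_M) : 'cV[R]_M :=
    gradient gammaR gamma (dx dt) V (J dt) (Q dt) in
  let source (V : 'cV[R]_M) : 'cV[R]_M := modified_source Psi F V (xR t) t in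
  let ElQR (dt : R) : R :=
    characteristic_step (l m) (lam m) velR dt
      (QR dt) (Gamma dt (QR dt)) (source (QR dt))
      (D dt m * rowdot (l m) (Qhat dt - QR dt)) in
  let ElQhat (dt : R) : R := rowdot (l m) (EQhat dt) in
  let slope (dt : R) : R := Num.max (lam m - velR) 0 * (gammaR / dx dt) in
  let order (dt : R) : R := `|dt ^+ 2| + `|dt ^+ k.+1| in
  (forall (dt : R) (n : 'I_M), 0 < dt ->
    rowdot (l n) (Qstep dt) =
      characteristic_step (l n) (lam n) velR dt
        (Qhat dt) (Gamma dt (Qhat dt)) (source (Qhat dt)) 0) ->
  (fun dt : R => `|Qstep dt - EQhat dt|) =O_ (0^'+) order ->
  (\forall dt \near 0^'+,
    P m - slope dt <= D dt m <= 2 / dt - slope dt - P m) ->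
  exists err : R -> R,
    err =O_ (0^'+) order /\
    \forall dt \near 0^'+,
      `|ElQR dt - ElQhat dt| <= `|rowdot (l m) (QR dt - Qhat dt)| + err dt.
Proof.
move=> velR dx Qhat EQhat Gamma source ElQR ElQhat slope order hstep hcons hDm.
exists (fun dt => `|rowdot (l m) (Qstep dt - EQhat dt)|); split.
  set C := \sum_(i < M) `|l m ord0 i|.
  have C0 : 0 <= C by apply: sumr_ge0 => i _.
  move/eqO_exP : hcons => [c /= c0 hc]; apply/eqO_exP.
  (* The summand 1 makes the constant positive, as a big O bound requires. *)
  exists ((C + 1) * c); first by rewrite mulr_gt0 // ltr_wpDl.
  apply: filterS hc => dt; rewrite !normr_id -mulrA => hc.
  apply: le_trans (ler_rowdot_norm _ _) _.
  by apply: ler_pM => //; rewrite lerDl.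
near=> dt.
have dt0 : 0 < dt by near: dt; exact: nbhs_right_gt.
have hDdt : P m - slope dt <= D dt m <= 2 / dt - slope dt - P m by near: dt.
have -> : ElQR dt - ElQhat dt =
    (ElQR dt - rowdot (l m) (Qstep dt)) + rowdot (l m) (Qstep dt - EQhat dt).
  by rewrite rowdotB addrA subrK.
apply: le_trans (ler_normD _ _) _; rewrite lerD2r.
set a := rowdot (l m) (QR dt - Qhat dt).
set b := rowdot (l m) (source (QR dt) - source (Qhat dt)).
have -> : ElQR dt - rowdot (l m) (Qstep dt)
    = a + dt * (b - (slope dt + D dt m) * a).
  have hG := rowdot_gradientB (l m) gammaR gamma (dx dt) (QR dt) (Qhat dt)
    (J dt) (Q dt).
  rewrite hstep // /ElQR /characteristic_step /slope /a /b.
  rewrite !rowdotB in hG *.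
  have {hG} -> : rowdot (l m) (Gamma dt (QR dt)) =
    gammaR / dx dt * (rowdot (l m) (QR dt) - rowdot (l m) (Qhat dt))
    + rowdot (l m) (Gamma dt (Qhat dt)) by rewrite -hG subrK.
  ring.
apply: (damped_step_contraction dt0 _ (hPsi m _ _)).
by lra.
Unshelve. all: by end_near.
Qed.
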